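(* Let $f(\bar S_T)$ be the payoff of the Asian option (one asset). If $f$ is continuous with linear growth, then, for each of delta, gamma and vega, the simulation estimate $\hat\theta_d$ is an asymptotically unbiased estimate of $\theta$ with respect to $d$, i.e. $$\lim_{d\to+\infty}\mathbb E_{\mathbb Q}[\hat\theta_d]=\mathbb E_{\mathbb Q}[\hat\theta]=\theta.$$
   Context: One-asset Black–Scholes model under the risk-neutral measure $\mathbb Q$: $S_t=S_0\exp(\omega t+\sigma\tilde W_t)$, $0\le t\le T$, where $S_0>0$, $r>0$, $\sigma\neq 0$, $\omega=r-\frac12\sigma^2$, and $\tilde W$ is a standard Brownian motion under $\mathbb Q$; $\bar S_T=\frac1T\int_0^TS_t\,dt$. The payoff function $f:\mathbb R\to\mathbb R$ is nonnegative and measurable. The Malliavin weights are functions of four variables $(x,s,y,z)$: - delta: $\mathrm{weight}(x,s,y,z)=\frac{2}{S_0\sigma^2}\big(\frac{s-S_0}{Tx}-\omega\big)$; - gamma: $\mathrm{weight}(x,s,y,z)=\frac{4}{\sigma^4S_0^2T^2x^2}\big(s^2-2sS_0+S_0^2+\omega rT^2x^2-2rTsx+2\omega TS_0x\big)$; - vega: $\mathrm{weight}(x,s,y,z)=\frac{2}{\sigma^2T^2x^2}\big((s-S_0-(r-\sigma^2)Tx)\,y-\sigma^2z-\frac{\sigma T^2}{2}x^2\big)$. For each of these Greeks, $$\hat\theta=e^{-rT}f(\bar S_T)\,\mathrm{weight}\Big(\bar S_T,S_T,\int_0^TS_t(\tilde W_t-\sigma t)dt,\int_0^TS_u\int_u^TS_t(\tilde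 W_t-\sigma t)dt\,du\Big),\qquad\theta=\mathbb E_{\mathbb Q}[\hat\theta].$$ For $d\ge1$ let $t_j=jT/d$ ($0\le j\le d$), $S_j=S_{t_j}$, $S_A=\frac1d\sum_{j=1}^dS_j$, and $$\hat\theta_d=e^{-rT}f(S_A)\,\mathrm{weight}\Big(S_A,S_d,\frac Td\sum_{j=1}^dS_j(\tilde W_{t_j}-\sigma t_j),\frac{T^2}{d^2}\sum_{i=1}^d\sum_{j=i}^dS_iS_j(\tilde W_{t_j}-\sigma t_j)\Big).$$ Linear growth means $|f(x)|\le C(1+|x|)$ for some constant $C>0$. *)

(* Defs.v *)
From mathcomp Require Import all_boot all_order all_algebra.
From mathcomp Require Import all_classical all_reals all_analysis.

Set Implicit Arguments.
Unset Strict Implicit.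
Unset Printing Implicit Defensive.

Import Order.TTheory GRing.Theory Num.Theory.
Import numFieldNormedType.Exports.

Local Open Scope classical_set_scope.
Local Open Scope ring_scope.

Section brownian_motion.
Context {dsp : measure_display} {Omega : measurableType dsp} {R : realType}.
Variable Q : probability Omega R.

(* Since the sets B i may be setT, the product rule for the whole finite family
   contains the product rule for each of its subfamilies. *)
Definition independent_rvs (I : finType) (X : I -> Omega -> R) : Prop :=
  forall B : I -> set R, (forall i, measurable (B i)) ->
    Q (\bigcap_(i in [set: I]) (X i @^-1` B i))
    = (\prod_(i : I) Q (X i @^-1` B i))%E.

(* Only the times in [0, T] matter: the values of W at other times are
   unconstrained.  The restriction s < t in bm_gauss is essential, because
   normal_prob 0 0 is the uniform law on [0, 1], not the Dirac mass at 0. *)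
Record standard_brownian_motion (T : R) (W : R -> Omega -> R) : Prop := {
  bm_measurable : forall t : R, 0 <= t <= T -> measurable_fun [set: Omega] (W t) ;
  bm_start : {ae Q, forall w, W 0 w = 0} ;
  bm_continuous : {ae Q, forall w,
    {within `[0, T], continuous (fun t => W t w)}} ;
  bm_gauss : forall s t : R, 0 <= s -> s < t -> t <= T ->
    forall A : set R, measurable A ->
      Q ((W t \- W s) @^-1` A) = normal_prob 0 (Num.sqrt (t - s)) A ;
  bm_independent_increments : forall (n : nat) (t : nat -> R),
    0 <= t 0%N -> (forall i, (i < n)%N -> t i <= t i.+1) -> t n <= T ->
    independent_rvs (fun i : 'I_n => W (t i.+1) \- W (t i)) }.

End brownian_motion.

Variant greek := Delta | Gamma | Vega.

Section asian_option.
Context {R : realType} {Omega : Type}.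
Variables (S0 r sigma T : R) (W : R -> Omega -> R) (f : R -> R).

Definition drift : R := r - sigma ^+ 2 / 2.

Definition stock (t : R) (w : Omega) : R :=
  S0 * expR (drift * t + sigma * W t w).

Definition weight (g : greek) (x s y z : R) : R :=
  match g with
  | Delta => 2 / (S0 * sigma ^+ 2) * ((s - S0) / (T * x) - drift)
  | Gamma => 4 / (sigma ^+ 4 * S0 ^+ 2 * T ^+ 2 * x ^+ 2)
             * (s ^+ 2 - 2 * s * S0 + S0 ^+ 2 + drift * r * T ^+ 2 * x ^+ 2
                - 2 * r * T * s * x + 2 * drift * T * S0 * x)
  | Vega => 2 / (sigma ^+ 2 * T ^+ 2 * x ^+ 2)
            * ((s - S0 - (r - sigma ^+ 2) * T * x) * y - sigma ^+ 2 * z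
               - sigma * T ^+ 2 / 2 * x ^+ 2)
  end.

Local Notation mu := (@lebesgue_measure R).

Definition stock_mean (w : Omega) : R :=
  T^-1 * \int[mu]_(t in `[0, T]) stock t w.

Definition weighted_stock (t : R) (w : Omega) : R :=
  stock t w * (W t w - sigma * t).

Definition theta_hat (g : greek) (w : Omega) : R :=
  expR (- (r * T)) * f (stock_mean w)
  * weight g (stock_mean w) (stock T w)
      (\int[mu]_(t in `[0, T]) weighted_stock t w)
      (\int[mu]_(u in `[0, T])
         (stock u w * \int[mu]_(t in `[u, T]) weighted_stock t w)).

Definition grid (d j : nat) : R := j%:R * T / d%:R.

Definition stock_avg (d : nat) (w : Omega) : R :=
  d%:R^-1 * \sum_(1 <= j < d.+1) stock (grid d j) w.

Definition theta_hat_discr (g : greek) (d : nat) (w : Omega) : R :=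
  expR (- (r * T)) * f (stock_avg d w)
  * weight g (stock_avg d w) (stock (grid d d) w)
      (T / d%:R * \sum_(1 <= j < d.+1) weighted_stock (grid d j) w)
      (T ^+ 2 / d%:R ^+ 2 * \sum_(1 <= i < d.+1) \sum_(i <= j < d.+1)
         stock (grid d i) w * weighted_stock (grid d j) w).

End asian_option.

Definition theta {dsp : measure_display} {Omega : measurableType dsp}
    {R : realType} (Q : probability Omega R) (S0 r sigma T : R)
    (W : R -> Omega -> R) (f : R -> R) (g : greek) : \bar R :=
  ('E_Q[theta_hat S0 r sigma T W f g])%E.

Definition linear_growth {R : realType} (f : R -> R) : Prop :=
  exists2 C : R, 0 < C & forall x, `|f x| <= C * (1 + `|x|).

(* Main.v *)
Require Import Defs.
From mathcomp Require Import all_boot all_order all_algebra.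
From mathcomp Require Import all_classical all_reals all_analysis.
From mathcomp Require Import measurable_realfun ring lra.
Import Order.TTheory GRing.Theory Num.Theory.
Import numFieldNormedType.Exports.
Local Open Scope classical_set_scope.
Local Open Scope ring_scope.

(** Every weight is a polynomial in [x^-1, x, s, y, z], and these arguments are
    means over the grid, or integrals, of [S_t] and [S_t (W_t - sigma t)].  Two
    facts give the convergence of the expectations: for almost every path the
    discrete estimates converge to the continuous one, and their second moments
    are bounded uniformly in [d].  A sequence bounded in L2 is uniformly
    integrable, so almost sure convergence passes to expectations
    ([L2_cvg_expectation]).

    Uniform moments.  A dominating random variable would involve the maximum of
    the path, hence a maximal inequality.  Bounding moments instead of paths
    avoids it: the families all of whose moments are bounded uniformly
    ([bounded_moments]) are stable under sums, products and, by convexity of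
    [x |-> x ^ p], under means over the grid ([bounded_moments_mean]).  So it is
    enough to look at one time at once, where [exp (a W_t)] has the explicit
    expectation [exp (a^2 t / 2)] ([bm_exponential_moment]).  The negative powers
    of [S_A] are harmless because the inverse of a mean is at most the mean of the
    inverses ([invr_mean_le]), and the inverse of [S_t] is again an exponential of
    the Brownian motion.

    Pathwise limits.  Along a continuous path the grid sums are Riemann sums.  The
    double sum is treated as a Riemann sum of [u |-> S_u * \int_u^T Y] in which
    the inner integral is itself replaced by a grid sum; this needs the inner
    error to be small uniformly in the starting point [u]
    ([riemann_tail_uniform]), and uniform continuity gives exactly that.  The
    denominators do not vanish in the limit since the mean of a positive
    continuous path is positive.

    The continuous estimate is only known to be a limit of measurable functions
    outside a null set, and nothing is known of it on that set, where the path
    may be discontinuous.  Its integral is nevertheless the one of its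
    restriction to the complement of the null set ([integral_patchC_null]), since
    the integral is a supremum over simple functions below the integrand. *)

(** * Arithmetic, harmonic and power means *)

Section means.
Context {R : realFieldType}.

(** Convexity of [x |-> x ^ (p + 1)] on the nonnegative half-line, in the form of
    the tangent line at [m]; averaged over the data with [m] their mean, the
    linear term disappears. *)
Lemma exprn_tangent (p : nat) (m x : R) : 0 <= m -> 0 <= x ->
  m ^+ p.+1 + p.+1%:R * m ^+ p * (x - m) <= x ^+ p.+1.
Proof.
move=> m0 x0; elim: p => [|p IH]; first by rewrite !expr1 expr0; lra.
rewrite [leRHS]exprS; apply: le_trans (ler_wpM2l x0 IH).
rewrite -subr_ge0 [leRHS](_ : _ = p.+1%:R * m ^+ p * (x - m) ^+ 2).
  by rewrite mulr_ge0 ?sqr_ge0// mulr_ge0// exprn_ge0.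
by rewrite !exprS -[in p.+2%:R]natr1; ring.
Qed.

Lemma ler_power_mean (p n : nat) (x : nat -> R) : (0 < n)%N ->
  `|n%:R^-1 * \sum_(1 <= j < n.+1) x j| ^+ p
    <= n%:R^-1 * \sum_(1 <= j < n.+1) `|x j| ^+ p.
Proof.
move=> n0; have n0' : n%:R != 0 :> R by rewrite pnatr_eq0 -lt0n.
case: p => [|p].
  rewrite expr0; under eq_bigr do rewrite expr0.
  by rewrite big_const_nat iter_addr_0 subn1 /= mulVf.
set m := n%:R^-1 * \sum_(1 <= j < n.+1) `|x j|.
have m0 : 0 <= m by rewrite mulr_ge0// sumr_ge0.
apply: (@le_trans _ _ (m ^+ p.+1)).
  rewrite lerXn2r// ?nnegrE//.
  by rewrite normrM ger0_norm// ler_wpM2l// ler_norm_sum.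
have tangent : \sum_(1 <= j < n.+1) (m ^+ p.+1 + p.+1%:R * m ^+ p * (`|x j| - m))
    <= \sum_(1 <= j < n.+1) `|x j| ^+ p.+1.
  by apply: ler_sum => j _; exact: exprn_tangent.
apply: le_trans (ler_wpM2l _ tangent); last by rewrite invr_ge0.
rewrite big_split /= -mulr_sumr sumrB !big_const_nat !iter_addr_0 subn1 /=.
rewrite -[m ^+ _ *+ n]mulr_natl -[m *+ n]mulr_natl mulrDr mulKf//.
by rewrite {4}/m mulVKf// subrr mulr0 mulr0 addr0.
Qed.

Lemma mean_gt0 (n : nat) (a : nat -> R) : (0 < n)%N ->
  (forall j, (0 < j <= n)%N -> 0 < a j) ->
  0 < n%:R^-1 * \sum_(1 <= j < n.+1) a j.
Proof.
move=> n0 a0; rewrite mulr_gt0 ?invr_gt0 ?ltr0n// big_nat_recl//= ltr_pwDl ?a0//.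
by rewrite big_nat sumr_ge0// => j /andP[j0 jn]; rewrite ltW// a0.
Qed.

(** The same tangent argument for the convex function [a |-> a^-1], whose tangent
    line at [m] is [a |-> m^-1 * (2 - m^-1 * a)]. *)
Lemma invr_mean_le (n : nat) (a : nat -> R) : (0 < n)%N ->
  (forall j, (0 < j <= n)%N -> 0 < a j) ->
  (n%:R^-1 * \sum_(1 <= j < n.+1) a j)^-1
    <= n%:R^-1 * \sum_(1 <= j < n.+1) (a j)^-1.
Proof.
move=> n0 a0; have m0 := mean_gt0 n a n0 a0.
set m := n%:R^-1 * _ in m0 *.
have n0' : n%:R != 0 :> R by rewrite pnatr_eq0 -lt0n.
have tangent j : (0 < j <= n)%N -> m^-1 * (2 - m^-1 * a j) <= (a j)^-1.
  move=> /a0 aj; rewrite -subr_ge0.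
  rewrite [leRHS](_ : _ = (a j)^-1 * (1 - m^-1 * a j) ^+ 2).
    by rewrite mulr_ge0 ?sqr_ge0// invr_ge0 ltW.
  by field; rewrite !gt_eqF.
have : \sum_(1 <= j < n.+1) m^-1 * (2 - m^-1 * a j) <= \sum_(1 <= j < n.+1) (a j)^-1.
  by rewrite !big_nat; apply: ler_sum => j /tangent.
rewrite -mulr_sumr sumrB -mulr_sumr big_const_nat iter_addr_0 subn1 /=.
have -> : \sum_(1 <= j < n.+1) a j = n%:R * m by rewrite /m mulVKf.
rewrite mulrCA mulVf ?gt_eqF// mulr1 -[2 *+ n]mulr_natr => le_sum.
rewrite ler_pdivlMl ?ltr0n//; apply: le_trans le_sum.
by rewrite mulrC ler_wpM2l ?invr_ge0 ?(ltW m0)//; lra.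
Qed.

End means.

(** * Families of random variables with uniformly bounded moments *)

Section measurability.
Context {dsp : measure_display} {Omega : measurableType dsp} {R : realType}.

Lemma measurable_sum_nat (m n : nat) (X : nat -> Omega -> R) :
  (forall j, (m <= j < n)%N -> measurable_fun setT (X j)) ->
  measurable_fun setT (fun w => \sum_(m <= j < n) X j w).
Proof.
move=> mX.
have -> : (fun w => \sum_(m <= j < n) X j w) =
    (fun w => \sum_(m <= j < n) if (m <= j < n)%N then X j w else 0).
  by apply/funext => w; rewrite big_nat big_mkcond.
by apply: measurable_sum => j; have := mX j; case: (m <= j < n)%N => // /(_ isT).
Qed.

Lemma measurable_invr_gt0 (X : Omega -> R) :
  measurable_fun setT X -> (forall w, 0 < X w) ->
  measurable_fun setT (fun w => (X w)^-1).
Proof.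
move=> mX X0; 
have -> : (fun w => (X w)^-1) = (fun w => expR (- ln (X w))).
  by apply/funext => w; rewrite expRN lnK ?posrE.
apply: measurableT_comp => //; apply: measurableT_comp => //.
by apply: measurableT_comp => //; exact: measurable_ln.
Qed.

End measurability.

Section bounded_moments.
Context {dsp : measure_display} {Omega : measurableType dsp} {R : realType}.
Variable Q : probability Omega R.

(** The predicate [D] restricts the index set: the moments of a Brownian motion are
    controlled only at times in [ ]0, T] ], and grid means only make sense for at
    least one step. *)
Definition bounded_moments {I : Type} (D : set I) (X : I -> Omega -> R) :=
  (forall i, D i -> measurable_fun [set: Omega] (X i)) /\
  forall p : nat, exists K : R, forall i, D i ->
    (\int[Q]_w (`|X i w| ^+ p)%:E <= K%:E)%E.

Lemma integral_le_scaleD (X A B : Omega -> R) (c K1 K2 : R) :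
  0 <= c ->
  measurable_fun setT X -> measurable_fun setT A -> measurable_fun setT B ->
  (forall w, 0 <= X w) -> (forall w, 0 <= A w) -> (forall w, 0 <= B w) ->
  (forall w, X w <= c * (A w + B w)) ->
  (\int[Q]_w (A w)%:E <= K1%:E)%E -> (\int[Q]_w (B w)%:E <= K2%:E)%E ->
  (\int[Q]_w (X w)%:E <= (c * (K1 + K2))%:E)%E.
Proof.
move=> c0 mX mA mB X0 A0 B0 XAB AK BK.
apply: (@le_trans _ _ (\int[Q]_w (c%:E * ((A w)%:E + (B w)%:E)))%E).
  apply: ge0_le_integral => //.
  - by move=> w _; rewrite lee_fin.
  - exact/measurable_EFinP.
  - apply: emeasurable_funM => //.
    by apply: emeasurable_funD; exact/measurable_EFinP.
  - by move=> w _; rewrite -EFinD -EFinM lee_fin.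
rewrite ge0_integralZl//; last 2 first.
- by apply: emeasurable_funD; exact/measurable_EFinP.
- by move=> w _; rewrite -EFinD lee_fin addr_ge0.
rewrite ge0_integralD//; first last.
- exact/measurable_EFinP.
- by move=> w _; rewrite lee_fin.
- exact/measurable_EFinP.
- by move=> w _; rewrite lee_fin.
rewrite EFinM EFinD lee_pmul ?lee_fin ?leeD//.
by rewrite adde_ge0// integral_ge0// => w _; rewrite lee_fin.
Qed.

Lemma measurable_norm_exprn (X : Omega -> R) p :
  measurable_fun setT X -> measurable_fun setT (fun w => `|X w| ^+ p).
Proof.
by move=> mX; apply: measurable_funX; exact: measurableT_comp.
Qed.

Lemma bounded_moments_le {I : Type} (D : set I) (X Y : I -> Omega -> R) :
  bounded_moments D Y -> (forall i, D i -> measurable_fun setT (X i)) ->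
  (forall i w, D i -> `|X i w| <= `|Y i w|) -> bounded_moments D X.
Proof.
move=> [mY bY] mX XY; split=> // p; have [K KY] := bY p.
exists K => i Di; apply: le_trans (KY i Di); apply: ge0_le_integral => //.
- exact/measurable_EFinP/measurable_norm_exprn/mX.
- exact/measurable_EFinP/measurable_norm_exprn/mY.
- by move=> w _; rewrite lee_fin lerXn2r ?nnegrE ?XY.
Qed.

Lemma bounded_moments_comp {I J : Type} (D : set I) (E : set J) (h : J -> I)
    (X : I -> Omega -> R) :
  bounded_moments D X -> (forall j, E j -> D (h j)) ->
  bounded_moments E (fun j => X (h j)).
Proof.
move=> [mX bX] ED; split=> [j /ED/mX//|p].
by have [K KX] := bX p; exists K => j /ED /KX.
Qed.

Lemma bounded_moments_cst {I : Type} (D : set I) (c : R) :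
  bounded_moments D (fun _ _ => c).
Proof.
split=> // p; exists (`|c| ^+ p) => i _.
by rewrite integral_cst// [X in (_ * X)%E](_ : _ = 1%E) ?mule1// -(probability_setT Q).
Qed.

Lemma bounded_momentsD {I : Type} (D : set I) (X Y : I -> Omega -> R) :
  bounded_moments D X -> bounded_moments D Y ->
  bounded_moments D (fun i w => X i w + Y i w).
Proof.
move=> [mX bX] [mY bY]; split=> [i Di|p].
  by apply: measurable_funD; [exact: mX|exact: mY].
have [K KX] := bX p; have [L LY] := bY p.
exists (2 ^+ p * (K + L)) => i Di.
apply: integral_le_scaleD (KX i Di) (LY i Di) => //.
- by apply: measurable_norm_exprn; apply: measurable_funD; [exact: mX|exact: mY].
- exact/measurable_norm_exprn/mX.
- exact/measurable_norm_exprn/mY.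
move=> w; rewrite mulrDr -!exprMn.
set x := X i w; set y := Y i w.
have xy := ler_normD x y.
have [le_xy|/ltW le_yx] := leP `|x| `|y|.
- rewrite -[leLHS]add0r lerD ?exprn_ge0 ?mulr_ge0// lerXn2r ?nnegrE ?mulr_ge0//.
  by lra.
- rewrite -[leLHS]addr0 lerD ?exprn_ge0 ?mulr_ge0// lerXn2r ?nnegrE ?mulr_ge0//.
  by lra.
Qed.

(** Cauchy-Schwarz is replaced by [a * b <= a^2 + b^2], applied to the p-th powers;
    this is why all moments are required at once. *)
Lemma bounded_momentsM {I : Type} (D : set I) (X Y : I -> Omega -> R) :
  bounded_moments D X -> bounded_moments D Y ->
  bounded_moments D (fun i w => X i w * Y i w).
Proof.
move=> [mX bX] [mY bY]; split=> [i Di|p].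
  by apply: measurable_funM; [exact: mX|exact: mY].
have [K KX] := bX (p * 2)%N; have [L LY] := bY (p * 2)%N.
exists (1 * (K + L)) => i Di.
apply: integral_le_scaleD (KX i Di) (LY i Di) => //.
- by apply: measurable_norm_exprn; apply: measurable_funM; [exact: mX|exact: mY].
- exact/measurable_norm_exprn/mX.
- exact/measurable_norm_exprn/mY.
move=> w; rewrite mul1r normrM exprMn !exprM.
by nra.
Qed.

(** By convexity, the p-th moment of a mean is at most the mean of the p-th
    moments, a bound which does not depend on the number of terms. *)
Lemma bounded_moments_mean {I : Type} (D : set I) (X : I -> Omega -> R)
    (h : nat -> nat -> I) :
  bounded_moments D X ->
  (forall d j, (0 < j <= d)%N -> D (h d j)) ->
  bounded_moments [set d | (0 < d)%N]
    (fun d w => d%:R^-1 * \sum_(1 <= j < d.+1) X (h d j) w).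
Proof.
move=> [mX bX] Dh.
have sumE d (F : nat -> R) : \sum_(1 <= j < d.+1) F j = \sum_(i < d) F i.+1.
  by rewrite big_add1 big_mkord.
have Dhi d (i : 'I_d) : D (h d i.+1) by apply: Dh; rewrite ltn_ord.
have mS d : measurable_fun setT
    (fun w => d%:R^-1 * \sum_(1 <= j < d.+1) X (h d j) w).
  under eq_fun do rewrite sumE.
  by apply: measurable_funM => //; apply: measurable_sum => i; exact/mX/Dhi.
split=> [d _|p]; first exact: mS.
have [K KX] := bX p; exists K => d d0.
have d0' : d%:R != 0 :> R by rewrite pnatr_eq0 -lt0n.
have mXp (i : 'I_d) : measurable_fun setT (fun w => (`|X (h d i.+1) w| ^+ p)%:E).
  by apply/measurable_EFinP/measurable_norm_exprn/mX/Dhi.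
apply: (@le_trans _ _ (\int[Q]_w ((d%:R^-1)%:E *
    \sum_(i < d) (`|X (h d i.+1) w| ^+ p)%:E))%E).
  apply: ge0_le_integral => //.

  - exact/measurable_EFinP/measurable_norm_exprn.
  - by apply: emeasurable_funM => //; exact: emeasurable_sum.
  - move=> w _; rewrite sumEFin -EFinM lee_fin.
    have := ler_power_mean p d (fun j => X (h d j) w) d0; by rewrite [in leRHS]sumE.
rewrite ge0_integralZl//; last 2 first.
- exact: emeasurable_sum.
- by move=> w _; rewrite sumEFin lee_fin sumr_ge0.
rewrite ge0_integral_sum//.
apply: (@le_trans _ _ ((d%:R^-1)%:E * \sum_(i < d) K%:E)%E).
  by rewrite lee_pmul2l ?lte_fin ?invr_gt0 ?ltr0n// lee_sum// => i _; exact/KX/Dhi.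
by rewrite sumEFin sumr_const card_ord -EFinM -[K *+ d]mulr_natl mulKf.
Qed.

Lemma bounded_momentsN {I : Type} (D : set I) (X : I -> Omega -> R) :
  bounded_moments D X -> bounded_moments D (fun i w => - X i w).
Proof.
move=> bX; apply: (bounded_moments_le _ _ X) => // [i Di|i w _].
  by apply: measurableT_comp => //; exact: bX.1.
by rewrite normrN.
Qed.

Lemma bounded_momentsX {I : Type} (D : set I) (X : I -> Omega -> R) n :
  bounded_moments D X -> bounded_moments D (fun i w => X i w ^+ n).
Proof.
move=> bX; elim: n => [|n IH].
  by under eq_fun do under eq_fun do rewrite expr0; exact: bounded_moments_cst.
by under eq_fun do under eq_fun do rewrite exprS; exact: bounded_momentsM.
Qed.

Lemma bounded_moments_norm {I : Type} (D : set I) (X : I -> Omega -> R) :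
  bounded_moments D X -> bounded_moments D (fun i w => `|X i w|).
Proof.
move=> bX; apply: (bounded_moments_le _ _ X) => // [i Di|i w _].
  by apply: measurableT_comp => //; exact: bX.1.
by rewrite normr_id.
Qed.

Lemma bounded_moments_deterministic {I : Type} (D : set I) (c : I -> R) (K : R) :
  (forall i, D i -> `|c i| <= K) -> bounded_moments D (fun i _ => c i).
Proof.
move=> cK; apply: (bounded_moments_le _ _ (fun _ _ => K)) => // [|i _ Di].
  exact: bounded_moments_cst.
by rewrite (le_trans (cK i Di))// ler_norm.
Qed.

End bounded_moments.

(** * Exponential moments of the Brownian motion *)

Section gaussian_exponential_moments.
Context {R : realType}.
Local Notation mu := (@lebesgue_measure R).

(** [normal_prob] is given by its values on sets; the density is recovered from the
    almost everywhere uniqueness of the Radon-Nikodym derivative. *)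
Lemma ge0_integral_normal_prob (m s : R) (h : R -> \bar R) :
  measurable_fun setT h -> (forall x, 0 <= h x)%E ->
  (\int[normal_prob m s]_x h x =
   \int[mu]_x (h x * (normal_pdf m s x)%:E))%E.
Proof.
move=> mh h0; have dom := normal_prob_dominates m s.
rewrite -(Radon_Nikodym_SigmaFinite.change_of_variables dom)//.
apply: ae_eq_integral => //.
- apply: emeasurable_funM => //; apply: (measurable_int mu).
  exact: Radon_Nikodym_SigmaFinite.f_integrable.
- apply: emeasurable_funM => //.
  by apply/measurable_EFinP; exact: measurable_normal_pdf.
- apply: ae_eqe_mul2l; apply: integral_ae_eq => //.
  + exact: Radon_Nikodym_SigmaFinite.f_integrable.
  + by apply/measurable_EFinP; exact: measurable_normal_pdf.
  + by move=> E _ mE; rewrite -Radon_Nikodym_SigmaFinite.f_integral.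
Qed.

(** Completing the square: multiplying the centred density by [exp (a x)] gives,
    up to a constant, the density centred at [a s^2]. *)
Lemma integral_normal_prob_expR (a s : R) : s != 0 ->
  (\int[normal_prob 0 s]_x (expR (a * x))%:E = (expR (a ^+ 2 * s ^+ 2 / 2))%:E)%E.
Proof.
move=> s0; rewrite ge0_integral_normal_prob//; last first.
  by apply/measurable_EFinP/measurableT_comp => //; exact: measurable_funM.
transitivity (\int[mu]_x ((expR (a ^+ 2 * s ^+ 2 / 2))%:E *
    (normal_pdf (a * s ^+ 2) s x)%:E))%E.
  apply: eq_integral => x _; rewrite -!EFinM !normal_pdfE// mulrCA [in RHS]mulrCA.
  congr (_ * _)%:E; rewrite /normal_fun -!expRD; congr expR.
  by rewrite -mulr_natr; field.
rewrite ge0_integralZl//.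
- by rewrite integral_normal_pdf mule1.
- by apply/measurable_EFinP; exact: measurable_normal_pdf.
- by move=> x _; rewrite lee_fin normal_pdf_ge0.
Qed.
End gaussian_exponential_moments.

Section brownian_moments.
Context {dsp : measure_display} {Omega : measurableType dsp} {R : realType}.
Variables (Q : probability Omega R) (T : R) (W : R -> Omega -> R).
Hypothesis W_bm : standard_brownian_motion Q T W.

(** The law is prescribed for increments only, so [W t] is first compared with
    [W t - W 0], which coincides with it almost surely. *)
Lemma bm_exponential_moment (a t : R) : 0 < t <= T ->
  (\int[Q]_w (expR (a * W t w))%:E = (expR (a ^+ 2 * t / 2))%:E)%E.
Proof.
move=> /andP[t0 tT]; have [mW W0 _ gaussW _] := W_bm.
have T0 : 0 <= T by apply: le_trans tT; exact: ltW.
have mWt : measurable_fun setT (W t) by apply: mW; rewrite (ltW t0).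
have mW0 : measurable_fun setT (W 0) by apply: mW; rewrite lexx.
have mexp : measurable_fun [set: R] (fun x : R => (expR (a * x))%:E).
  by apply/measurable_EFinP/measurableT_comp => //; exact: measurable_funM.
have mincr : measurable_fun setT (W t \- W 0) by exact: measurable_funB.
transitivity (\int[Q]_w (expR (a * (W t \- W 0) w))%:E)%E.
  apply: ae_eq_integral => //.
  - exact: (measurableT_comp mexp).
  - exact: (measurableT_comp mexp).
  - by apply: filterS W0 => w /= -> _; rewrite subr0.
(* [normal_prob] lives on the copy [measurableTypeR R] of the real line *)
pose incr : Omega -> measurableTypeR R := W t \- W 0.
transitivity (\int[pushforward Q incr]_x (expR (a * x))%:E)%E.
  by rewrite ge0_integral_pushforward.
transitivity (\int[normal_prob 0 (Num.sqrt t)]_x (expR (a * x))%:E)%E.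
  apply: eq_measure_integral => A mA _.
  by have := gaussW _ _ (lexx 0) t0 tT _ mA; rewrite subr0.
rewrite integral_normal_prob_expR ?sqr_sqrtr ?(ltW t0)//.
by rewrite gt_eqF// sqrtr_gt0.
Qed.

Lemma bm_expR_bounded_moments (a : R) :
  bounded_moments Q `]0, T]%classic (fun t w => expR (a * W t w)).
Proof.
split=> [t /=|p].
  rewrite in_itv/= => /andP[t0 tT]; apply: measurableT_comp => //.
  by apply: measurable_funM => //; apply: (bm_measurable W_bm); rewrite (ltW t0).
exists (expR ((p%:R * a) ^+ 2 * T / 2)) => t /=; rewrite in_itv/= => tT.
under eq_integral do rewrite ger0_norm ?expR_ge0// -expRM_natl mulrA.
rewrite bm_exponential_moment// lee_fin ler_expR ler_wpM2r// ler_wpM2l ?sqr_ge0//.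
by case/andP: tT.
Qed.

(** [|x| <= exp x + exp (- x)] reduces to the exponential moments. *)
Lemma bm_bounded_moments : bounded_moments Q `]0, T]%classic W.
Proof.
apply: (bounded_moments_le _ _ _ (fun t w => expR (1 * W t w) + expR (-1 * W t w))).
- by apply: bounded_momentsD; exact: bm_expR_bounded_moments.
- move=> t /=; rewrite in_itv/= => /andP[t0 tT].
  by apply: (bm_measurable W_bm); rewrite (ltW t0).
- move=> t w _; rewrite mul1r mulN1r [leRHS]ger0_norm ?addr_ge0 ?expR_ge0//.
  have le1 (x : R) : x <= expR x by apply: le_trans (expR_ge1Dx x); rewrite lerDr.
  have [_|_] := ger0P (W t w).
  + by rewrite (le_trans (le1 _))// lerDl expR_ge0.
  + by rewrite (le_trans (le1 _))// lerDr expR_ge0.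
Qed.

End brownian_moments.

(** * Convergence of expectations under a uniform second moment bound *)

Section integral_null_set.
Import HBNNSimple.
Context {d : measure_display} {T : measurableType d} {R : realType}.
Variable mu : {measure set T -> \bar R}.

(** The integral of a nonnegative function, measurable or not, is the supremum of
    the integrals of the simple functions below it, and cutting a simple function
    off on a null set does not change its integral. *)
Lemma ge0_integral_patchC_null (N : set T) (f : T -> \bar R) :
  measurable N -> mu N = 0%E -> (forall x, 0 <= f x)%E ->
  (\int[mu]_x f x = \int[mu]_x (f \_ (~` N)) x)%E.
Proof.
move=> mN N0 f0; have fN0 x : (0 <= (f \_ (~` N)) x)%E by exact: erestrict_ge0.
rewrite !ge0_integralTE//; apply/eqP; rewrite eq_le; apply/andP; split.
- apply: ge_ereal_sup => _ [h /= hf <-].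
  pose h' := proj_nnsfun h (measurableC mN).
  have h'E x : h' x = (h \_ (~` N)) x by rewrite (mrestrict h (measurableC mN)).
  have -> : sintegral mu h = sintegral mu h'.
    rewrite -!integralT_nnsfun; apply: ae_eq_integral => //.
    + exact/measurable_EFinP.
    + exact/measurable_EFinP.
    + exists N; split=> // x /not_implyP[_ hh]; apply: contra_notP hh => Nx.
      by rewrite h'E patchE mem_set.
  apply: ereal_sup_ubound; exists h' => // x.
  by rewrite h'E !patchE; case: ifPn.
- apply: le_ereal_sup => _ [h /= hf <-]; exists h => // x.
  by apply: le_trans (hf x) _; rewrite patchE; case: ifPn.
Qed.

Lemma integral_patchC_null (N : set T) (f : T -> \bar R) :
  measurable N -> mu N = 0%E ->
  (\int[mu]_x f x = \int[mu]_x (f \_ (~` N)) x)%E.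
Proof.
move=> mN N0; rewrite integralE [RHS]integralE funepos_restrict funeneg_restrict.
by congr (_ - _)%E; apply: ge0_integral_patchC_null.
Qed.

End integral_null_set.

Section L2_bounded_convergence.
Context {d : measure_display} {Omega : measurableType d} {R : realType}.
Variable Q : probability Omega R.

Lemma L2_integrable (X : Omega -> R) (K : R) :
  measurable_fun setT X -> (\int[Q]_w (X w ^+ 2)%:E <= K%:E)%E ->
  Q.-integrable setT (EFin \o X).
Proof.
move=> mX XK; have mX2 : measurable_fun setT (fun w => (X w ^+ 2)%:E).
  exact/measurable_EFinP/measurable_funX.
apply: (@le_integrable _ _ _ _ _ _ _ (fun w => 1%:E + (X w ^+ 2)%:E)%E) => //.
- exact/measurable_EFinP.
- move=> w _ /=; rewrite lee_fin [leRHS]ger0_norm ?addr_ge0 ?sqr_ge0//.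
  by have := sqr_ge0 (`|X w| - 1); rewrite -[X w ^+ 2]real_normK ?num_real//; nra.
- apply: integrableD => //; first exact: finite_measure_integrable_cst.
  apply/integrableP; split=> //.
  under eq_integral do rewrite gee0_abs ?lee_fin ?sqr_ge0//.
  exact: le_lt_trans XK (ltry _).
Qed.

Lemma L2_fatou (X : nat -> Omega -> R) (Y : Omega -> R) (K : R) :
  (forall n, measurable_fun setT (X n)) ->
  (forall n, \int[Q]_w (X n w ^+ 2)%:E <= K%:E)%E ->
  (forall w, X n w @[n --> \oo] --> Y w) ->
  (\int[Q]_w (Y w ^+ 2)%:E <= K%:E)%E.
Proof.
move=> mX XK XY.
have limE w : (Y w ^+ 2)%:E = limn_einf (fun n => (X n w ^+ 2)%:E).
  have cX2 : (X n w ^+ 2)%:E @[n --> \oo] --> (Y w ^+ 2)%:E.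
    apply: cvg_EFin; first exact: nearW.
    exact: (cvgM (XY w) (XY w)).
  by rewrite is_cvg_limn_einfE; [exact/esym/cvg_lim|apply/cvg_ex; eexists; exact: cX2].
under eq_integral do rewrite limE.
apply: le_trans (fatou _ _ _ _) _ => //.
- by move=> n; exact/measurable_EFinP/measurable_funX.
- by move=> n w _; rewrite lee_fin sqr_ge0.
rewrite limn_einf_lim; apply: lime_le; first exact: is_cvg_einfs.
apply: nearW => n; apply: le_trans (XK n).
by apply: ereal_inf_lbound; exists n => /=.
Qed.

(** Uniform integrability by hand: with [D = |X n - Y|] one has
    [D <= min (D, M) + D^2 / M].  The truncated part tends to 0 in mean by
    dominated convergence, the second one is small for [M] large, uniformly in
    [n]. *)
Lemma L2_cvg_integral (X : nat -> Omega -> R) (Y : Omega -> R) (K : R) :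
  (forall n, measurable_fun setT (X n)) -> measurable_fun setT Y ->
  (forall n, \int[Q]_w (X n w ^+ 2)%:E <= K%:E)%E ->
  (forall w, X n w @[n --> \oo] --> Y w) ->
  (\int[Q]_w (X n w)%:E)%E @[n --> \oo] --> (\int[Q]_w (Y w)%:E)%E.
Proof.
move=> mX mY XK XY.
have YK := L2_fatou X Y K mX XK XY.
have iX n := L2_integrable (X n) K (mX n) (XK n).
have iY := L2_integrable Y K mY YK.
have K0 : 0 <= K.
  rewrite -lee_fin; apply: le_trans YK; apply: integral_ge0 => w _.
  by rewrite lee_fin sqr_ge0.
pose D n w := `|X n w - Y w|.
have mD n : measurable_fun setT (D n).
  by apply: measurableT_comp => //; exact: measurable_funB.
have D0 w : D n w @[n --> \oo] --> (0 : R).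
  rewrite -[X in _ --> X](normr0 R) -(subrr (Y w)); apply: cvg_norm.
  by apply: cvgB; [exact: XY|exact: cvg_cst].
have DK n : (\int[Q]_w (D n w ^+ 2)%:E <= (2 * (K + K))%:E)%E.
  apply: integral_le_scaleD (XK n) YK => //.
  - exact: measurable_funX.
  - exact: measurable_funX.
  - exact: measurable_funX.
  - by move=> w; exact: sqr_ge0.
  - by move=> w; exact: sqr_ge0.
  - by move=> w; exact: sqr_ge0.
  move=> w; rewrite /D real_normK ?num_real//.
  by have := sqr_ge0 (X n w + Y w); lra.
have iD n := L2_integrable (D n) _ (mD n) (DK n).
pose trunc M n w := Num.min (D n w) M.
have mtr M n : measurable_fun setT (trunc M n).
  by apply: measurable_minr => //; exact: measurable_cst.
have trunc0 (M : R) : 0 < M -> (\int[Q]_w (trunc M n w)%:E)%E @[n --> \oo] --> 0%E.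
  move=> M0.
  have [|||||_ _] := @dominated_convergence _ _ _ Q setT measurableT
    (fun n w => (trunc M n w)%:E) (cst 0%E) (cst M%:E).
  - by move=> n; exact/measurable_EFinP.
  - exact: measurable_cst.
  - apply: nearW => w _; apply: cvg_EFin; first exact: nearW.
    apply: (squeeze_cvgr _ (cvg_cst 0) (D0 w)); apply: nearW => n /=.
    by rewrite le_min normr_ge0 ltW//= ge_min lexx.
  - exact: finite_measure_integrable_cst.
  - apply: nearW => w n _ /=; rewrite lee_fin /trunc ger0_norm.
      by rewrite ge_min lexx orbT.
    by rewrite le_min normr_ge0 ltW.
  by rewrite integral0.
have cD : (\int[Q]_w (D n w)%:E)%E @[n --> \oo] --> 0%E.
  apply: cvg_EFin; first by apply: nearW => n; apply: integrable_fin_num (iD n).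
  apply/cvgrPdist_le => /= e e0.
  (* [E (D^2)] is at most [4 K], so this level makes [E (D^2) / M] at most [e / 2] *)
  pose M := 2 * (4 * K + 1) / e.
  have M0 : 0 < M by rewrite divr_gt0// mulr_gt0// ltr_wpDl// mulr_ge0.
  have /fine_cvg/cvgrPdist_le/(_ (e / 2)) := trunc0 M M0.
  have e20 : 0 < e / 2 by rewrite divr_gt0.
  move=> /(_ e20); apply: filterS => n /=; rewrite !sub0r !normrN => tr_n.
  have trfin : (\int[Q]_w (trunc M n w)%:E)%E \is a fin_num.
    apply: integrable_fin_num => //; apply: le_integrable (iD n) => //.
      exact/measurable_EFinP.
    move=> w _ /=; rewrite lee_fin ler_norml; apply/andP; split.
      by rewrite (@le_trans _ _ 0) ?oppr_le0// le_min normr_ge0 ltW.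
    by rewrite ge_min ler_norm.
  rewrite ger0_norm; last by apply: fine_ge0; apply: integral_ge0 => w _; rewrite lee_fin normr_ge0.
  rewrite -lee_fin fineK; last exact: integrable_fin_num (iD n).
  have {}tr_n : (\int[Q]_w (trunc M n w)%:E <= (e / 2)%:E)%E.
    by rewrite -(fineK trfin) lee_fin (le_trans (ler_norm _)).
  apply: (@le_trans _ _ (1 * (e / 2 + M^-1 * (2 * (K + K))))%:E).
    have DMK : (\int[Q]_w (M^-1 * D n w ^+ 2)%:E <= (M^-1 * (2 * (K + K)))%:E)%E.
      under eq_integral do rewrite EFinM.
      rewrite ge0_integralZl//.
      - by rewrite EFinM lee_pmul2l// lte_fin invr_gt0.
      - exact/measurable_EFinP/measurable_funX.
      - by move=> w _; rewrite lee_fin sqr_ge0.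
      - by rewrite lee_fin invr_ge0 ltW.
    apply: integral_le_scaleD tr_n DMK => //.
    - by apply: measurable_funM => //; exact: measurable_funX.
    - by move=> w; exact: normr_ge0.
    - by move=> w; rewrite /trunc le_min normr_ge0 ltW.
    - by move=> w; rewrite mulr_ge0 ?sqr_ge0// invr_ge0 ltW.
    move=> w; rewrite mul1r /trunc; have [_|MD] := leP (D n w) M.
      by rewrite lerDl mulr_ge0 ?sqr_ge0// invr_ge0 ltW.
    rewrite (@le_trans _ _ (M^-1 * D n w ^+ 2)) ?lerDr ?(ltW M0)//.
    by rewrite ler_pdivlMl// expr2 ler_wpM2r ?(ltW MD)//; exact: normr_ge0.
  rewrite lee_fin mul1r /M invf_div invfM (mulrA e).
  rewrite -(mulrA (e / 2)) [leRHS]splitr lerD2l ler_piMr ?(ltW e20)//.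
  by rewrite ler_pdivrMl ?ltr_wpDl ?mulr_ge0//; lra.
have XYD n : (`|\int[Q]_w (X n w)%:E - \int[Q]_w (Y w)%:E| <= \int[Q]_w (D n w)%:E)%E.
  rewrite -(integralB measurableT (iX n) iY).
  have mXY : measurable_fun setT ((EFin \o X n) \- (EFin \o Y))%E.
    by apply: emeasurable_funB; exact/measurable_EFinP.
  exact: le_trans (le_abse_integral Q measurableT mXY) _.
apply/sube_cvg0; first exact: integrable_fin_num iY.
apply/cvg_abse0P; apply: (squeeze_cvge _ (cvg_cst 0%E) cD).
by apply: nearW => n; rewrite abse_ge0 XYD.
Qed.

(** The form used for path functionals, whose limit is identified only almost
    surely and may fail to be measurable on the exceptional null set. *)
Lemma L2_cvg_expectation (X : nat -> Omega -> R) (Y : Omega -> R) (K : R) :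
  (forall n, measurable_fun setT (X n)) ->
  (forall n, \int[Q]_w (X n w ^+ 2)%:E <= K%:E)%E ->
  {ae Q, forall w, X n w @[n --> \oo] --> Y w} ->
  ('E_Q[Y] \is a fin_num)%E /\ ('E_Q[X n])%E @[n --> \oo] --> ('E_Q[Y])%E.
Proof.
move=> mX XK [N [mN N0 XYN]]; rewrite unlock.
have EN (F : Omega -> R) : (\int[Q]_w (F w)%:E = \int[Q]_w ((F \_ (~` N)) w)%:E)%E.
  rewrite (@integral_patchC_null _ _ _ Q N)//.
  by under eq_integral do rewrite restrict_EFin.
have mXN n : measurable_fun setT (X n \_ (~` N)).
  by apply/(measurable_restrictT _ (measurableC mN))/measurable_funTS.
have XYN' w : (X n \_ (~` N)) w @[n --> \oo] --> (Y \_ (~` N)) w.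
  have [wN|wN] := boolP (w \in ~` N).
    rewrite (_ : (fun n => _) = X^~ w); last by apply/funext => n; rewrite patchE wN.
    rewrite patchE wN; move: wN; rewrite inE => wN.
    by apply: contrapT => XYw; apply: wN; exact: XYN.
  rewrite patchE (negbTE wN) (_ : (fun n => _) = cst 0); first exact: cvg_cst.
  by apply/funext => n; rewrite patchE (negbTE wN).
have XNK n : (\int[Q]_w ((X n \_ (~` N)) w ^+ 2)%:E <= K%:E)%E.
  apply: le_trans (XK n); apply: ge0_le_integral => //.
  - by move=> w _; rewrite lee_fin sqr_ge0.
  - exact/measurable_EFinP/measurable_funX.
  - exact/measurable_EFinP/measurable_funX.
  - move=> w _; rewrite lee_fin patchE; case: ifPn => // _.
    by rewrite expr0n sqr_ge0.
have mYN : measurable_fun setT (Y \_ (~` N)).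
  by apply: (measurable_fun_cvg mXN) => w _; exact: XYN'.
split.
  rewrite EN; apply: integrable_fin_num => //.
  exact: L2_integrable _ _ mYN (L2_fatou _ _ _ mXN XNK XYN').
rewrite EN; under eq_fun do rewrite EN.
exact: L2_cvg_integral _ _ _ mXN mYN XNK XYN'.
Qed.

End L2_bounded_convergence.

(** * Riemann sums on the grid *)

Section segment.
Context {R : realType}.
Local Notation mu := (@lebesgue_measure R).

(** Heine-Cantor: a given [delta] works near each point, so compactness yields one
    that works everywhere. *)
Lemma segment_uniformly_continuous (g : R -> R) (a b : R) :
  {within `[a, b], continuous g} -> forall e, 0 < e ->
  exists2 delta, 0 < delta & forall x y, x \in `[a, b] -> y \in `[a, b] ->
    `|x - y| <= delta -> `|g x - g y| <= e.
Proof.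
move=> /subspace_continuousP cg e e0.
pose P (delta x : R) := forall y, y \in `[a, b] -> `|x - y| <= delta -> `|g x - g y| <= e.
have /near_covering_withinP cover :=
  (compact_near_coveringP `[a, b]%classic).1 (@segment_compact R a b).
have : \forall delta \near 0^'+, `[a, b]%classic `<=` P delta.
  apply: cover => x /= xab.
  have : 0 < e / 2 by rewrite divr_gt0.
  have /cvgrPdist_le cgx := cg x xab.
  move=> /cgx; rewrite near_withinE => -[rho /= rho0 near_x].
  have rho20 : 0 < rho / 2 by rewrite divr_gt0.
  have {}near_x y : y \in `[a, b] -> `|x - y| < rho -> `|g x - g y| <= e / 2.
    by move=> yab xy; exact: near_x.
  exists (ball x (rho / 2), [set delta | delta <= rho / 2]); first split.
  - exact: nbhsx_ballx.
  - exact: nbhs_right_le.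
  move=> [x' delta] /= [xx' delta_rho] x'ab y yab x'y.
  have xx'e : `|g x - g x'| <= e / 2.
    apply: near_x => //; move: xx'; rewrite /ball/= => xx'; lra.
  have xye : `|g x - g y| <= e / 2.
    apply: near_x => //; move: xx'; rewrite /ball/= => xx'.
    by have := ler_distD x' x y; lra.
  by have := ler_distD (g x) (g x') (g y); rewrite (distrC (g x') (g x)); lra.
move=> near_cover; near (0 : R)^'+ => delta; exists delta => //.
move=> x y xab yab; have : `[a, b]%classic `<=` P delta by near: delta.
by move=> /(_ x xab); exact.
Unshelve. all: by end_near. Qed.

Variables (T : R).
Hypothesis T_gt0 : 0 < T.

Section primitive.
Variable g : R -> R.
Hypothesis cg : {within `[0, T], continuous g}.

Let F x := \int[mu]_(t in `[0, x]) g t.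

Lemma continuous_integrable_sub a b : 0 <= a -> b <= T ->
  mu.-integrable `[a, b] (EFin \o g).
Proof.
move=> a0 bT; apply: continuous_compact_integrable; first exact: segment_compact.
by apply: continuous_subspaceW cg; apply: subset_itvScc; rewrite bnd_simp.
Qed.

Lemma primitive_continuous : {within `[0, T], continuous F}.
Proof.
apply: parameterized_integral_continuous; first exact: ltW.
exact: continuous_integrable_sub.
Qed.

Lemma integral_tailE u : 0 <= u <= T ->
  \int[mu]_(t in `[u, T]) g t = F T - F u.
Proof.
move=> /andP[u0 uT]; rewrite /F Rintegral_itvB ?bnd_simp//; last first.
  exact: continuous_integrable_sub.
rewrite Rintegral_itv_obnd_cbnd//.
apply: integrableS (continuous_integrable_sub u T u0 (lexx _)) => //.
exact: subset_itv_oc_cc.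
Qed.

(** The fundamental theorem of calculus and the mean value theorem: over one mesh
    the integral of [g] is a value of [g] times the mesh. *)
Lemma primitive_mean_value x y : 0 <= x -> x <= y -> y <= T ->
  exists2 c, c \in `[x, y] & F y - F x = g c * (y - x).
Proof.
move=> x0 xy yT; apply: MVT_segment => //; last first.
  by apply: continuous_subspaceW primitive_continuous; apply: subset_itvScc; rewrite bnd_simp.
move=> t; rewrite in_itv/= => /andP[xt ty].
have t0 : 0 < t by apply: le_lt_trans xt.
have tT : t < T by apply: lt_le_trans yT.
have gt : {for t, continuous g}.
  move/(continuous_within_itvP _ T_gt0): cg => [+ _ _]; apply.
  by rewrite in_itv/= t0.
have [dF F'] := continuous_FTC1_closed tT
  (continuous_integrable_sub 0 T (lexx _) (lexx _)) t0 gt.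
by apply: DeriveDef; [exact: dF|rewrite -derive1E; exact: F'].
Qed.

End primitive.

Lemma gridS d j : grid T d j.+1 = grid T d j + T / d%:R.
Proof. by rewrite /grid -natr1 mulrDl mul1r mulrDl. Qed.

Lemma grid0 d : grid T d 0 = 0.
Proof. by rewrite /grid mul0r mul0r. Qed.

Lemma grid_last d : (0 < d)%N -> grid T d d = T.
Proof. by move=> d0; rewrite /grid mulrAC mulfV ?mul1r// pnatr_eq0 -lt0n. Qed.

Lemma grid_ge0 d j : 0 <= grid T d j.
Proof. by rewrite /grid !mulr_ge0 ?invr_ge0// ltW. Qed.

Lemma grid_gt0 d j : (0 < d)%N -> (0 < j)%N -> 0 < grid T d j.
Proof. by move=> d0 j0; rewrite /grid !mulr_gt0 ?invr_gt0 ?ltr0n. Qed.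

Lemma grid_le d j : (j <= d)%N -> grid T d j <= T.
Proof.
case: d => [|d] jd; first by rewrite (_ : j = 0%N) ?grid0 ?ltW//; case: j jd.
by rewrite /grid ler_pdivrMr// mulrC ler_wpM2l ?(ltW T_gt0)// ler_nat.
Qed.

Lemma near_mesh_le e : 0 < e -> \forall d \near \oo, T / d%:R <= e.
Proof.
move=> e0; near=> d.
have d0 : 0 < d%:R :> R by rewrite ltr0n; near: d; exact: nbhs_infty_gt.
rewrite ler_pdivrMr// mulrC -ler_pdivrMr//.
by near: d; exact: nbhs_infty_ger.
Unshelve. all: by end_near. Qed.

(** Each mesh contributes an error at most [e / d] once the oscillation of [g] over
    a mesh is at most [e / T]; the bound does not see where the sum starts. *)
Lemma riemann_tail_uniform (g : R -> R) : {within `[0, T], continuous g} ->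
  forall e, 0 < e -> \forall d \near \oo, forall i, (i <= d)%N ->
  `|T / d%:R * \sum_(i.+1 <= j < d.+1) g (grid T d j)
    - \int[mu]_(t in `[grid T d i, T]) g t| <= e.
Proof.
move=> cg e e0; have eT0 : 0 < e / T by rewrite divr_gt0.
have [delta delta0 uc] := segment_uniformly_continuous g 0 T cg _ eT0.
near=> d => i id.
have d0 : (0 < d)%N by near: d; exact: nbhs_infty_gt.
have d0' : d%:R != 0 :> R by rewrite pnatr_eq0 -lt0n.
have mesh : T / d%:R <= delta by near: d; exact: near_mesh_le.
have mesh0 : 0 <= T / d%:R by rewrite divr_ge0// ltW.
rewrite integral_tailE//; last by rewrite grid_ge0 grid_le.
set F := fun x => \int[mu]_(t in `[0, x]) g t.
rewrite -[X in _ - (F X - _)](grid_last d)//.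
rewrite -(telescope_sumr (fun j => F (grid T d j)) id) big_add1 /= mulr_sumr -sumrB.
apply: le_trans (ler_norm_sum _ _ _) _.
apply: (@le_trans _ _ (\sum_(i <= j < d) e / d%:R)); last first.
  rewrite big_const_nat iter_addr_0 -[_ *+ (d - i)]mulr_natl mulrCA ler_piMr ?(ltW e0)//.
  by rewrite ler_pdivrMr ?ltr0n// mul1r ler_nat leq_subr.
rewrite !big_nat; apply: ler_sum => j /andP[_ jd].
have [|||c cxy ->] := primitive_mean_value g cg (grid T d j) (grid T d j.+1).
- exact: grid_ge0.
- by rewrite gridS lerDl.
- exact: grid_le.
move: cxy; rewrite in_itv/= gridS => /andP[jc cj].
rewrite addrAC subrr add0r mulrC -mulrBl normrM (ger0_norm mesh0).
have -> : e / d%:R = e / T * (T / d%:R) by rewrite mulrA divfK// gt_eqF.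
have j0 := grid_ge0 d j; have jT := grid_le d j.+1 jd; rewrite gridS in jT.
apply: ler_wpM2r => //; apply: uc; rewrite ?in_itv/=.
- by rewrite jT addr_ge0.
- by rewrite (le_trans j0 jc) (le_trans cj jT).
- by rewrite ger0_norm ?subr_ge0//; lra.
Unshelve. all: by end_near. Qed.

Lemma riemann_sum_cvg (g : R -> R) : {within `[0, T], continuous g} ->
  T / d%:R * \sum_(1 <= j < d.+1) g (grid T d j) @[d --> \oo]
    --> \int[mu]_(t in `[0, T]) g t.
Proof.
move=> cg; apply/cvgrPdist_le => e e0.
have := riemann_tail_uniform g cg e e0; apply: filterS => d /(_ 0%N isT).
by rewrite grid0 distrC.
Qed.

(** With [H u] the integral of [Y] over [ [u, T] ], the inner sum started at step
    [i] is close to [H (t_(i-1))] by [riemann_tail_uniform], hence to [H (t_i)] by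
    uniform continuity, and what remains is a Riemann sum of [S * H]. *)
Lemma riemann_double_sum_cvg (S Y : R -> R) :
  {within `[0, T], continuous S} -> {within `[0, T], continuous Y} ->
  T ^+ 2 / d%:R ^+ 2 * \sum_(1 <= i < d.+1) \sum_(i <= j < d.+1)
      S (grid T d i) * Y (grid T d j) @[d --> \oo]
    --> \int[mu]_(u in `[0, T]) (S u * \int[mu]_(t in `[u, T]) Y t).
Proof.
move=> cS cY.
pose F x := \int[mu]_(t in `[0, x]) Y t; pose H u := F T - F u.
have HE u : 0 <= u <= T -> \int[mu]_(t in `[u, T]) Y t = H u by exact: integral_tailE.
have cH : {within `[0, T], continuous H}.
  apply: (@within_continuousB _ _ _ _ (cst (F T)) F).
    by apply: continuous_subspaceT; exact: cst_continuous.
  exact: primitive_continuous.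
have cSH : {within `[0, T], continuous (fun u => S u * H u)}.
  by move=> x; apply: cvgM; [exact: cS|exact: cH].
have -> : \int[mu]_(u in `[0, T]) (S u * \int[mu]_(t in `[u, T]) Y t) =
          \int[mu]_(u in `[0, T]) (S u * H u).
  by apply: eq_Rintegral => u; rewrite inE/= in_itv/= => uT; rewrite HE.
have [c cT Sc] : exists2 c, c \in `[0, T] & forall t, t \in `[0, T] -> `|S t| <= `|S c|.
  have cnS : {within `[0, T], continuous (fun t => `|S t|)}.
    by move=> x; apply: cvg_norm; exact: cS.
  by have [c cT Sc] := EVT_max (ltW T_gt0) cnS; exists c.
have T10 : 0 < T * (`|S c| + 1) by rewrite mulr_gt0// ltr_wpDl.
apply/cvgrPdist_le => e e0.
(* a third of [e] for the outer Riemann sum, two thirds for the inner sums: their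
   two errors [e'] are multiplied by at most [|S c|] and summed over a length [T];
   the added 1 keeps the divisor positive *)
pose e' := e / 3 / (T * (`|S c| + 1)).
have e30 : 0 < e / 3 by rewrite divr_gt0.
have e'0 : 0 < e' by rewrite divr_gt0.
have [delta delta0 uc] := segment_uniformly_continuous H 0 T cH _ e'0.
have /cvgrPdist_le/(_ _ e30) SH := riemann_sum_cvg _ cSH.
near=> d.
have d0 : (0 < d)%N by near: d; exact: nbhs_infty_gt.
have mesh : T / d%:R <= delta by near: d; exact: near_mesh_le.
have mesh0 : 0 <= T / d%:R by rewrite divr_ge0// ltW.
have SHd : `|\int[mu]_(t in `[0, T]) (S t * H t) -
   T / d%:R * \sum_(1 <= j < d.+1) (S (grid T d j) * H (grid T d j))| <= e / 3.
  by near: d; exact: SH.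
have tail i : (i <= d)%N -> `|T / d%:R * \sum_(i.+1 <= j < d.+1) Y (grid T d j)
    - \int[mu]_(t in `[grid T d i, T]) Y t| <= e'.
  by move: i; near: d; exact: (riemann_tail_uniform Y cY e' e'0).
set outer := T / d%:R * _ in SHd; apply: le_trans (ler_distD outer _ _) _.
rewrite [leRHS](_ : e = e / 3 + 2 * (e / 3)); last by field.
apply: lerD => //.
have -> : T ^+ 2 / d%:R ^+ 2 * \sum_(1 <= i < d.+1) \sum_(i <= j < d.+1)
      S (grid T d i) * Y (grid T d j) =
    T / d%:R * \sum_(1 <= i < d.+1) S (grid T d i) *
      (T / d%:R * \sum_(i <= j < d.+1) Y (grid T d j)).
  under eq_bigr do rewrite -mulr_sumr.
  under [in RHS]eq_bigr do rewrite mulrCA.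
  by rewrite -mulr_sumr mulrA -expr2 -exprVn -exprMn.
rewrite -mulrBr -sumrB normrM (ger0_norm mesh0).
apply: (@le_trans _ _ (T / d%:R * \sum_(1 <= i < d.+1) (`|S c| * (2 * e')))).
  apply: ler_wpM2l => //; apply: le_trans (ler_norm_sum _ _ _) _.
  rewrite !big_nat; apply: ler_sum => i /andP[i1 id].
  have iT : grid T d i \in `[0, T] by rewrite in_itv/= grid_ge0 grid_le.
  rewrite -mulrBr normrM ler_pM ?Sc//.
  case: i i1 id iT => // i _ id iT; have {}id : (i <= d)%N by rewrite ltnW.
  have iT' : grid T d i \in `[0, T] by rewrite in_itv/= grid_ge0 grid_le.
  have := tail i id; rewrite HE; last by rewrite in_itv/= in iT'.
  have : `|H (grid T d i) - H (grid T d i.+1)| <= e'.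
    apply: uc => //; rewrite gridS opprD addrA subrr add0r normrN ger0_norm//.
  set t := T / d%:R * _.
  have := ler_distD (H (grid T d i)) (H (grid T d i.+1)) t.
  rewrite (distrC (H (grid T d i)) t) (distrC (H (grid T d i.+1)) (H _)).
  by lra.
rewrite big_const_nat iter_addr_0 subn1 /= -[_ * _ *+ d]mulr_natl.
rewrite (mulrA (T / d%:R)) divfK; last by rewrite pnatr_eq0 -lt0n.
have e'E : e' * (T * (`|S c| + 1)) = e / 3 by rewrite /e' divfK// gt_eqF.
have Te'0 : 0 <= T * e' by rewrite mulr_ge0// ltW.
by rewrite -e'E; nra.
Unshelve. all: by end_near. Qed.

End segment.

(** * The weights as polynomials *)

Section weight.
Context {R : realType} (S0 r sigma T : R).

(** All divisions are gathered into powers of [x^-1], so that limits and moment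
    bounds follow from closure under sums and products. *)
Lemma weightE g (x s y z : R) : weight S0 r sigma T g x s y z =
  match g with
  | Delta => 2 / (S0 * sigma ^+ 2) * ((s - S0) * (T^-1 * x^-1) - drift r sigma)
  | Gamma => 4 / (sigma ^+ 4 * S0 ^+ 2 * T ^+ 2) * x^-1 ^+ 2
             * (s ^+ 2 - 2 * s * S0 + S0 ^+ 2
                + drift r sigma * r * T ^+ 2 * x ^+ 2
                - 2 * r * T * s * x + 2 * drift r sigma * T * S0 * x)
  | Vega => 2 / (sigma ^+ 2 * T ^+ 2) * x^-1 ^+ 2
            * ((s - S0 - (r - sigma ^+ 2) * T * x) * y - sigma ^+ 2 * z
               - sigma * T ^+ 2 / 2 * x ^+ 2)
  end.
Proof. by case: g; rewrite /weight -?exprVn !invfM ?mulrA. Qed.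

Lemma weight_cvg g (x s y z : nat -> R) (x' s' y' z' : R) : x' != 0 ->
  x @ \oo --> x' -> s @ \oo --> s' -> y @ \oo --> y' -> z @ \oo --> z' ->
  weight S0 r sigma T g (x n) (s n) (y n) (z n) @[n --> \oo]
    --> weight S0 r sigma T g x' s' y' z'.
Proof.
move=> x0 cx cs cy cz; rewrite weightE; under eq_fun do rewrite weightE.
have cV : (x n)^-1 @[n --> \oo] --> x'^-1 by exact: cvgV.
have cX2 (u : nat -> R) (l : R) : u @ \oo --> l -> u n ^+ 2 @[n --> \oo] --> l ^+ 2.
  by move=> cu; exact: (cvgM cu cu).
have k (c : R) : c @[n --> \oo] --> c by exact: cvg_cst.
case: g.
- exact: cvgM (k _) (cvgB (cvgM (cvgB cs (k S0)) (cvgM (k _) cV)) (k _)).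
- apply: cvgM (cvgM (k _) (cX2 _ _ cV)) _; apply: cvgD _ (cvgM (k _) cx).
  apply: cvgB _ (cvgM (cvgM (k _) cs) cx); apply: cvgD _ (cvgM (k _) (cX2 _ _ cx)).
  exact: cvgD (cvgB (cX2 _ _ cs) (cvgM (cvgM (k _) cs) (k _))) (k _).
- apply: cvgM (cvgM (k _) (cX2 _ _ cV)) _; apply: cvgB _ (cvgM (k _) (cX2 _ _ cx)).
  apply: cvgB _ (cvgM (k _) cz); apply: cvgM _ cy.
  exact: cvgB (cvgB cs (k _)) (cvgM (k _) cx).
Qed.

Lemma weight_bounded_moments {dsp : measure_display} {Omega : measurableType dsp}
    (Q : probability Omega R) {I : Type} (D : set I)
    g (x s y z : I -> Omega -> R) :
  bounded_moments Q D x -> bounded_moments Q D (fun i w => (x i w)^-1) ->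
  bounded_moments Q D s -> bounded_moments Q D y -> bounded_moments Q D z ->
  bounded_moments Q D
    (fun i w => weight S0 r sigma T g (x i w) (s i w) (y i w) (z i w)).
Proof.
move=> bx bV bs bY bz; under eq_fun do under eq_fun do rewrite weightE.
have k (c : R) : bounded_moments Q D (fun _ _ => c) by exact: bounded_moments_cst.
have A := @bounded_momentsD _ _ _ Q _ D; have M := @bounded_momentsM _ _ _ Q _ D.
have N := @bounded_momentsN _ _ _ Q _ D; have X := @bounded_momentsX _ _ _ Q _ D.
case: g.
- exact: (M _ _ (k _) (A _ _ (M _ _ (A _ _ bs (k _)) (M _ _ (k _) bV)) (k _))).
- apply: (M _ _ (M _ _ (k _) (X _ 2 bV)) _); apply: (A _ _ _ (M _ _ (k _) bx)).
  apply: (A _ _ _ (N _ (M _ _ (M _ _ (k _) bs) bx))).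
  apply: (A _ _ _ (M _ _ (k _) (X _ 2 bx))).
  exact: (A _ _ (A _ _ (X _ 2 bs) (N _ (M _ _ (M _ _ (k _) bs) (k _)))) (k _)).
- apply: (M _ _ (M _ _ (k _) (X _ 2 bV)) _); apply: (A _ _ _ (N _ (M _ _ (k _) (X _ 2 bx)))).
  apply: (A _ _ _ (N _ (M _ _ (k _) bz))); apply: (M _ _ _ bY).
  exact: (A _ _ (A _ _ bs (k _)) (N _ (M _ _ (k _) bx))).
Qed.

End weight.

(** * Moments and pathwise limits of the estimates *)

Section asian_option.
Context {dsp : measure_display} {Omega : measurableType dsp} {R : realType}.
Variable Q : probability Omega R.
Variables (S0 r sigma T : R) (W : R -> Omega -> R) (f : R -> R).
Hypotheses (S0_gt0 : 0 < S0) (T_gt0 : 0 < T).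
Hypothesis W_bm : standard_brownian_motion Q T W.
Hypotheses (f_meas : measurable_fun [set: R] f) (f_cont : continuous f).
Hypothesis f_lin : linear_growth f.
Local Notation mu := (@lebesgue_measure R).
Local Notation S := (stock S0 r sigma W).
Local Notation Y := (weighted_stock S0 r sigma W).
Local Notation times := (`]0, T]%classic : set R).
Local Notation steps := [set d : nat | (0 < d)%N].

Lemma stock_gt0 t w : 0 < S t w.
Proof. by rewrite /stock mulr_gt0// expR_gt0. Qed.

Lemma times_range t : times t -> 0 <= t <= T.
Proof. by rewrite /= in_itv/= => /andP[/ltW-> ->]. Qed.

Lemma drift_time_bounded_moments (c : R) :
  bounded_moments Q times (fun t _ => expR (c * t)).
Proof.
apply: (bounded_moments_deterministic _ _ _ (expR (`|c| * T))) => t /times_range.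
move=> /andP[t0 tT]; rewrite ger0_norm ?expR_ge0// ler_expR.
by rewrite (le_trans (ler_norm _))// normrM (ger0_norm t0) ler_wpM2l.
Qed.

Lemma stock_bounded_moments : bounded_moments Q times S.
Proof.
have -> : S = (fun t w => S0 * (expR (drift r sigma * t) * expR (sigma * W t w))).
  by apply/funext => t; apply/funext => w; rewrite /stock expRD.
apply: bounded_momentsM; first exact: bounded_moments_cst.
apply: bounded_momentsM; first exact: drift_time_bounded_moments.
exact: bm_expR_bounded_moments W_bm _.
Qed.

Lemma stock_inv_bounded_moments : bounded_moments Q times (fun t w => (S t w)^-1).
Proof.
have -> : (fun t w => (S t w)^-1) = (fun t w =>
    S0^-1 * (expR (- drift r sigma * t) * expR (- sigma * W t w))).
  by apply/funext => t; apply/funext => w; rewrite /stock invfM -expRN -expRD opprD !mulNr.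
apply: bounded_momentsM; first exact: bounded_moments_cst.
apply: bounded_momentsM; first exact: drift_time_bounded_moments.
exact: bm_expR_bounded_moments W_bm _.
Qed.

Lemma weighted_stock_bounded_moments : bounded_moments Q times Y.
Proof.
apply: bounded_momentsM; first exact: stock_bounded_moments.
apply: bounded_momentsD; first exact: bm_bounded_moments W_bm.
apply: (bounded_moments_deterministic _ _ _ (`|sigma| * T)) => t /times_range.
by move=> /andP[t0 tT]; rewrite normrN normrM (ger0_norm t0) ler_wpM2l.
Qed.

Lemma grid_times d j : (0 < j <= d)%N -> times (grid T d j).
Proof.
move=> /andP[j0 jd]; rewrite /= in_itv/= grid_le// andbT grid_gt0//.
exact: leq_trans jd.
Qed.

Lemma stock_avg_gt0 d w : (0 < d)%N -> 0 < stock_avg S0 r sigma T W d w.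
Proof. by move=> d0; apply: mean_gt0 => // j _; exact: stock_gt0. Qed.

Lemma stock_avg_bounded_moments :
  bounded_moments Q steps (stock_avg S0 r sigma T W).
Proof.
exact: (bounded_moments_mean _ _ _ (grid T) stock_bounded_moments grid_times).
Qed.

Lemma stock_avg_inv_bounded_moments :
  bounded_moments Q steps (fun d w => (stock_avg S0 r sigma T W d w)^-1).
Proof.
apply: (bounded_moments_le _ _ _ _ (bounded_moments_mean _ _ _ (grid T)
  stock_inv_bounded_moments grid_times)) => [d d0|d w d0].
  apply: measurable_invr_gt0 => [|w]; last exact: stock_avg_gt0.
  exact: stock_avg_bounded_moments.1.
rewrite ger0_norm ?invr_ge0 ?(ltW (stock_avg_gt0 _ _ d0))//.
apply: le_trans (ler_norm _); apply: invr_mean_le => // j _; exact: stock_gt0.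
Qed.

Lemma single_sum_bounded_moments :
  bounded_moments Q steps
    (fun d w => T / d%:R * \sum_(1 <= j < d.+1) Y (grid T d j) w).
Proof.
have -> : (fun d w => T / d%:R * \sum_(1 <= j < d.+1) Y (grid T d j) w) =
    (fun d w => T * (d%:R^-1 * \sum_(1 <= j < d.+1) Y (grid T d j) w)).
  by apply/funext => d; apply/funext => w; rewrite mulrA.
apply: bounded_momentsM; first exact: bounded_moments_cst.
exact: (bounded_moments_mean _ _ _ (grid T) weighted_stock_bounded_moments grid_times).
Qed.

(** The sum over [i <= j] is dominated by the sum over all pairs, which is a product
    of two means. *)
Lemma double_sum_bounded_moments :
  bounded_moments Q steps
    (fun d w => T ^+ 2 / d%:R ^+ 2 * \sum_(1 <= i < d.+1) \sum_(i <= j < d.+1)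
         S (grid T d i) w * Y (grid T d j) w).
Proof.
apply: (bounded_moments_le _ _ _ (fun d w => T ^+ 2 *
    ((d%:R^-1 * \sum_(1 <= i < d.+1) S (grid T d i) w) *
     (d%:R^-1 * \sum_(1 <= j < d.+1) `|Y (grid T d j) w|)))).
- apply: bounded_momentsM; first exact: bounded_moments_cst.
  apply: bounded_momentsM; first exact: stock_avg_bounded_moments.
  exact: (bounded_moments_mean _ _ _ (grid T)
    (bounded_moments_norm _ _ _ weighted_stock_bounded_moments) grid_times).
- move=> d _; apply: measurable_funM => //.
  apply: measurable_sum_nat => i /andP[i1 id].
  apply: measurable_sum_nat => j /andP[ij jd].
  apply: measurable_funM.
    by apply: stock_bounded_moments.1; apply: grid_times; rewrite i1.
  apply: weighted_stock_bounded_moments.1; apply: grid_times.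
  by rewrite (leq_trans i1 ij).
- move=> d w d0; rewrite [leRHS]ger0_norm; last first.
    rewrite mulr_ge0 ?sqr_ge0// mulr_ge0// mulr_ge0 ?invr_ge0 ?sumr_ge0// => i _.
    exact/ltW/stock_gt0.
  rewrite normrM ger0_norm ?divr_ge0 ?exprn_ge0 ?ler0n ?(ltW T_gt0)//.
  have scaleE a b : T ^+ 2 * (d%:R^-1 * a * (d%:R^-1 * b)) = T ^+ 2 / d%:R ^+ 2 * (a * b).
    by rewrite -exprVn; ring.
  rewrite scaleE ler_wpM2l ?divr_ge0 ?sqr_ge0//.
  rewrite mulr_suml; apply: le_trans (ler_norm_sum _ _ _) _.
  rewrite big_nat [leRHS]big_nat; apply: ler_sum => i /andP[i1 id].
  rewrite -mulr_sumr normrM gtr0_norm ?stock_gt0// ler_wpM2l ?(ltW (stock_gt0 _ _))//.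
  apply: le_trans (ler_norm_sum _ _ _) _.
  by rewrite [leRHS](big_cat_nat i1 (ltnW id))/= lerDr sumr_ge0.
Qed.

Lemma payoff_bounded_moments {I : Type} (D : set I) (X : I -> Omega -> R) :
  bounded_moments Q D X -> bounded_moments Q D (fun i w => f (X i w)).
Proof.
move=> bX; have [C C0 fC] := f_lin.
apply: (bounded_moments_le _ _ _ (fun i w => C * (1 + `|X i w|))).
- apply: bounded_momentsM; first exact: bounded_moments_cst.
  by apply: bounded_momentsD; [exact: bounded_moments_cst|exact: bounded_moments_norm].
- by move=> i Di; apply: measurableT_comp => //; exact: bX.1.
- by move=> i w _; rewrite (le_trans (fC _))// ler_norm.
Qed.

Lemma theta_hat_discr_bounded_moments g :
  bounded_moments Q steps (theta_hat_discr S0 r sigma T W f g).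
Proof.
apply: bounded_momentsM.
  apply: bounded_momentsM; first exact: bounded_moments_cst.
  exact/payoff_bounded_moments/stock_avg_bounded_moments.
apply: weight_bounded_moments.
- exact: stock_avg_bounded_moments.
- exact: stock_avg_inv_bounded_moments.
- apply: (bounded_moments_comp _ _ _ (fun d => grid T d d) _ stock_bounded_moments).
  by move=> d d0; apply: grid_times; rewrite leqnn andbT.
- exact: single_sum_bounded_moments.
- exact: double_sum_bounded_moments.
Qed.

Section path.
Variable w : Omega.
Hypothesis cW : {within `[0, T], continuous (fun t => W t w)}.

Lemma stock_path_continuous : {within `[0, T], continuous (fun t => S t w)}.
Proof.
have cid : {within `[0, T], continuous (@idfun R)}.
  by apply: continuous_subspaceT => t; exact: cvg_id.
move=> t; apply: cvgM; first exact: cvg_cst.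
apply: (cvg_comp (fun t => drift r sigma * t + sigma * W t w) expR); last first.
  exact: continuous_expR.
apply: cvgD; first by apply: cvgM; [exact: cvg_cst|exact: cid].
by apply: cvgM; [exact: cvg_cst|exact: cW].
Qed.

Lemma weighted_stock_path_continuous :
  {within `[0, T], continuous (fun t => Y t w)}.
Proof.
have cid : {within `[0, T], continuous (@idfun R)}.
  by apply: continuous_subspaceT => t; exact: cvg_id.
move=> t; apply: cvgM; first exact: stock_path_continuous.
apply: cvgB; first exact: cW.
by apply: cvgM; [exact: cvg_cst|exact: cid].
Qed.

(** By the mean value theorem the mean is a value of the path. *)
Lemma stock_mean_gt0 : 0 < stock_mean S0 r sigma T W w.
Proof.
have cS := stock_path_continuous.
rewrite /stock_mean mulr_gt0 ?invr_gt0// (integral_tailE _ _ cS)//; last first.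
  by rewrite lexx ltW.
have [||| c _ ->] := primitive_mean_value T T_gt0 _ cS 0 T => //; first exact: ltW.
by rewrite subr0 mulr_gt0// stock_gt0.
Qed.

Lemma stock_avg_cvg :
  stock_avg S0 r sigma T W d w @[d --> \oo] --> stock_mean S0 r sigma T W w.
Proof.
have cS := riemann_sum_cvg _ T_gt0 _ stock_path_continuous.
have -> : (stock_avg S0 r sigma T W)^~ w = (fun d => T^-1 *
    (T / d%:R * \sum_(1 <= j < d.+1) S (grid T d j) w)).
  by apply/funext => d; rewrite /stock_avg !mulrA mulVf ?mul1r// gt_eqF.
by apply: cvgM; [exact: cvg_cst|exact: cS].
Qed.

Lemma theta_hat_discr_cvg g :
  theta_hat_discr S0 r sigma T W f g d w @[d --> \oo]
    --> theta_hat S0 r sigma T W f g w.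
Proof.
have cavg := stock_avg_cvg.
apply: cvgM.
  by apply: cvgM; [exact: cvg_cst|apply: continuous_cvg cavg; exact: f_cont].
apply: weight_cvg.
- by rewrite gt_eqF// stock_mean_gt0.
- exact: cavg.
- apply: cvg_near_cst; near=> d; rewrite grid_last//.
  by near: d; exact: nbhs_infty_gt.
- exact: riemann_sum_cvg _ T_gt0 _ weighted_stock_path_continuous.
- exact: riemann_double_sum_cvg _ T_gt0 _ _ stock_path_continuous weighted_stock_path_continuous.
Unshelve. all: by end_near. Qed.

End path.
End asian_option.

(** * Asymptotic unbiasedness *)

Theorem theorem5p4 (dsp : measure_display) (Omega : measurableType dsp)
    (R : realType) (Q : probability Omega R)
    (S0 r sigma T : R) (W : R -> Omega -> R) (f : R -> R)
    (S0_gt0 : 0 < S0) (r_gt0 : 0 < r) (sigma_neq0 : sigma != 0) (T_gt0 : 0 < T)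
    (W_bm : standard_brownian_motion Q T W)
    (f_ge0 : forall x, 0 <= f x) (f_meas : measurable_fun [set: R] f)
    (f_cont : continuous f) (f_lin : linear_growth f) (g : greek) :
  [/\ forall d : nat, (0 < d)%N ->
        Q.-integrable [set: Omega]
          (EFin \o theta_hat_discr S0 r sigma T W f g d),
      theta Q S0 r sigma T W f g \is a fin_num,
      ('E_Q[theta_hat_discr S0 r sigma T W f g d])%E @[d --> \oo]
        --> ('E_Q[theta_hat S0 r sigma T W f g])%E
    & ('E_Q[theta_hat S0 r sigma T W f g])%E = theta Q S0 r sigma T W f g ].
Proof.
have [mtheta btheta] : bounded_moments Q [set d : nat | (0 < d)%N]
  (theta_hat_discr S0 r sigma T W f g) by exact: theta_hat_discr_bounded_moments.
have [K KX] := btheta 2%N.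
have L2 d : (0 < d)%N ->
    (\int[Q]_w (theta_hat_discr S0 r sigma T W f g d w ^+ 2)%:E <= K%:E)%E.
  move=> d0; apply: le_trans (KX d d0).
  by under [leRHS]eq_integral do rewrite real_normK ?num_real//.
(* grids with no step are excluded by shifting the index *)
have path_cvg : {ae Q, forall w, theta_hat_discr S0 r sigma T W f g n.+1 w
    @[n --> \oo] --> theta_hat S0 r sigma T W f g w}.
  apply: filterS (bm_continuous W_bm) => w cW.
  rewrite (cvg_shiftS (fun n => theta_hat_discr S0 r sigma T W f g n w)).
  exact: theta_hat_discr_cvg.
have [theta_fin theta_cvg] := L2_cvg_expectation Q
  (fun n => theta_hat_discr S0 r sigma T W f g n.+1) _ K
  (fun n => mtheta n.+1 isT) (fun n => L2 n.+1 isT) path_cvg.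
split=> //.
- by move=> d d0; exact: L2_integrable (mtheta d d0) (L2 d d0).
- by rewrite -(cvg_shiftS (fun d => 'E_Q[theta_hat_discr S0 r sigma T W f g d]%E)).
Qed.
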